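(* Let $X$ be a compact metrizable space with at least three points which has at most countably many connected components. Then $X$ is topologically reconstructible; that is, every topological space $Y$ with $\mathcal{D}(Y)=\mathcal{D}(X)$ is homeomorphic to $X$.
   Context: For a topological space $X$, the deck is $\mathcal{D}(X)=\{[X\setminus\{x\}] : x\in X\}$, where $[Z]$ denotes the homeomorphism class of $Z$ and $X \setminus \{x\}$ carries the subspace topology (the deck is a set, without multiplicities). $X$ is topologically reconstructible if $\mathcal{D}(X)=\mathcal{D}(Y)$ implies $X\cong Y$ for every topological space $Y$. Standing convention: all spaces considered have at least three points. *)

(* Defs.v *)
From mathcomp Require Import all_boot all_order all_algebra.
From mathcomp Require Import all_classical all_reals all_analysis.

Set Implicit Arguments.
Unset Strict Implicit.
Unset Printing Implicit Defensive.

Local Open Scope classical_set_scope.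

Definition homeomorphic (X Y : topologicalType) : Prop :=
  exists (f : X -> Y) (g : Y -> X),
    [/\ continuous f, continuous g, cancel f g & cancel g f].

(* Collections of spaces are plain predicates: [topologicalType] is too large
   a type to be an argument of [set]. *)
Definition homeo_class (Z : topologicalType) : topologicalType -> Prop :=
  fun W => homeomorphic Z W.

(* [set_type] carries the topology induced by the inclusion; the library's
   [subspace] would instead keep the point x, as an isolated one. *)
Definition point_deleted (X : topologicalType) (x : X) : topologicalType :=
  set_type (~` [set x]).

Definition deck (X : topologicalType) : (topologicalType -> Prop) -> Prop :=
  fun C => exists x : X, C = homeo_class (point_deleted x).

Definition reconstructible (X : topologicalType) : Prop :=
  forall Y : topologicalType, deck X = deck Y -> homeomorphic X Y.

Definition metrizable (R : realType) (X : topologicalType) : Prop :=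
  exists M : metricType R, homeomorphic X M.

Definition at_least_three_points (T : Type) : Prop :=
  exists a b c : T, [/\ a <> b, a <> c & b <> c].

(* Main.v *)
From HB Require Import structures.
Require Import Defs.
From mathcomp Require Import all_boot all_order all_algebra.
From mathcomp Require Import all_classical all_reals all_analysis.

Set Implicit Arguments.
Unset Strict Implicit.
Unset Printing Implicit Defensive.

Local Open Scope classical_set_scope.

(* If Y has the deck of X, then Y is Hausdorff and locally compact, and if Y is
   moreover compact, X and Y are both one-point compactifications of a common
   card. If Y is not compact, then X has no isolated point. Say that x is split
   n times if some punctured neighbourhood of x is a disjoint union of n open
   sets accumulating at x. Assume that every point of X, hence of Y, is split n
   times, and match X minus x with Y minus y: the n pieces at y and the end of Y
   give n + 1 pieces at x. So every point of X is split 3 times. By Baire, some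
   component C of X has nonempty interior. As C is connected, each piece at an
   interior point x of C contains, together with x, a nondegenerate connected
   arm through x. As for the branch points of a dendrite, x is determined by
   basic open sets chosen inside the pieces and meeting the arms: another point
   with the same data misses two of the arms at x, whose union is connected but
   would meet two of its pieces. So the interior of C is countable, and by Baire
   again X has an isolated point. *)

(** * Compactness and Baire category *)

(** If no member of [C] lay inside [O], the parts of the members outside [O] would generate a proper
    filter; a cluster point of it lies in every closed member but not in the open [O]. *)
Lemma compact_closed_basis (T : topologicalType) (C : set (set T)) (O : set T) :
    compact [set: T] -> C !=set0 ->
    (forall A B, C A -> C B -> exists2 D, C D & D `<=` A `&` B) ->
    (forall A, C A -> closed A) -> open O ->
    \bigcap_(A in C) A `<=` O ->
  exists2 A, C A & A `<=` O.
Proof.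
move=> cT [A0 CA0] CI Ccl oO CO; apply: contrapT => nO.
pose F := filter_from C (fun A => A `\` O).
have FF : ProperFilter F.
  apply: filter_from_proper.
    apply: filter_from_filter; first by exists A0.
    move=> A B CA CB; have [D CD DAB] := CI A B CA CB.
    by exists D => // z [/DAB[Az Bz] nOz].
  move=> A CA; apply: contrapT => /nonemptyPn AO; apply: nO; exists A => //.
  by rewrite -setD_eq0.
have [p [_ clp]] := cT F FF (filterT).
have FC A : C A -> F (A `\` O) by move=> CA; exists A.
have Op : O p.
  apply: CO => A CA; apply: (Ccl A CA) => B nB.
  by have [q [[Aq _] Bq]] := clp _ _ (FC A CA) nB; exists q.
by have [q [[_ +] Oq]] := clp _ _ (FC A0 CA0) (open_nbhs_nbhs (conj oO Op)).
Qed.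

Lemma compact_hausdorff_shrink (T : topologicalType) (x : T) (N : set T) :
  compact [set: T] -> hausdorff_space T -> nbhs x N ->
  exists V, [/\ open V, V x & closure V `<=` N].
Proof.
move=> cT hT xN; have [V xV clV] := compact_regular hT cT filterT xN.
exists V°; split; [exact: open_interior|exact: xV|].
exact: subset_trans (closureS (@interior_subset _ _)) clV.
Qed.

(** Nested nonempty open sets [W n] are chosen inside [U], the closure of each [W n.+1] missing the
    n-th member of an enumeration of [D]. A point common to these closures would lie in [U] but in
    no member of [D], so by compactness one closure is empty, which is absurd. *)
Theorem Baire_compact (T : topologicalType) (D : set (set T)) (U : set T) :
    compact [set: T] -> hausdorff_space T -> countable D ->
    (forall A, D A -> closed A) -> open U -> U !=set0 ->
    U `<=` \bigcup_(A in D) A ->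
  exists2 A, D A & A° !=set0.
Proof.
move=> cT hT cD Dcl oU U0 UD; apply: contrapT => nint.
have : $|{surjfun [set: nat] >-> D}|.
  case/pfcard_geP : cD => // D0.
  by case: U0 => x /UD; rewrite D0 bigcup_set0.
case=> F.
have DF n : D (F n) by apply: (@funS _ _ _ _ F).
have step (n : nat) (V : set T) : open V /\ V !=set0 ->
    exists W, [/\ open W, W !=set0 & closure W `<=` V `\` F n].
  move=> [oV [v Vv]].
  have oVF : open (V `\` F n) by apply: openI => //; apply: closed_openC; exact: Dcl.
  have [x Vx] : V `\` F n !=set0.
    apply: contrapT => /nonemptyPn; rewrite setD_eq0 => VF; apply: nint.
    exists (F n) => //; exists v; apply: (filterS VF).
    exact: open_nbhs_nbhs (conj oV Vv).
  have [W [oW Wx WV]] :=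
    compact_hausdorff_shrink cT hT (open_nbhs_nbhs (conj oVF Vx)).
  by exists W; split => //; exists x.
have /choice[next nextP] (p : nat * set T) : exists W,
    open p.2 /\ p.2 !=set0 -> [/\ open W, W !=set0 & closure W `<=` p.2 `\` F p.1].
  case: p => n V /=.
  have [/(step n)[W WP]|nV] := pselect (open V /\ V !=set0); first by exists W.
  by exists set0 => /nV.
pose W := fix W n := if n is m.+1 then next (m, W m) else U.
have WP n : open (W n) /\ W n !=set0.
  by elim: n => //= n ih; have [] := nextP (n, W n) ih.
have Wn n : closure (W n.+1) `<=` W n `\` F n by have [] := nextP (n, W n) (WP n).
have Wdec m n : (m <= n)%N -> closure (W n.+1) `<=` closure (W m.+1).
  elim: n => [|n ih]; first by rewrite leqn0 => /eqP ->.
  rewrite leq_eqVlt => /predU1P[-> //|/ih]; apply: subset_trans.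
  apply: subset_trans (@subset_closure _ _); apply: subset_trans (Wn _) _.
  exact: subDsetl.
have [|||||_ [n _ <-]] :=
    @compact_closed_basis T (range (fun n => closure (W n.+1))) set0 cT.
- by exists (closure (W 1%N)); exists 0%N.
- move=> _ _ [m _ <-] [n _ <-]; exists (closure (W (maxn m n).+1)).
    by exists (maxn m n).
  by rewrite subsetI; split; apply: Wdec; rewrite ?leq_maxl ?leq_maxr.
- by move=> _ [n _ <-]; exact: closed_closure.
- exact: open0.
- move=> p pW.
  have [A DA Ap] : (\bigcup_(A in D) A) p.
    apply/UD; have /Wn[] // : closure (W 1%N) p by apply: pW; exists 0%N.
  have [n _ Fn] := @surj _ _ _ _ F A DA.
  have /Wn[_] : closure (W n.+1) p by apply: pW; exists n.
  by rewrite Fn.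
- have [_ [q Wq]] := WP n.+1.
  by move=> /(_ q (subset_closure Wq)).
Qed.

(** * Quasicomponents and arms *)

(** For closed [M], the sets [N] are the relatively clopen subsets of [M] around [x], expressed
    through closed sets of [T] only. *)
Definition quasicomponent (T : topologicalType) (M : set T) (x : T) : set T :=
  \bigcap_(N in [set N | [/\ N x, N `<=` M, closed N & closed (M `\` N)]]) N.

Section quasicomponent.
Variables (T : topologicalType) (M : set T) (x : T).
Hypotheses (cT : compact [set: T]) (hT : hausdorff_space T).
Hypotheses (Mcl : closed M) (Mx : M x).

Lemma quasicomponent_refl : quasicomponent M x x.
Proof. by move=> N []. Qed.

Lemma quasicomponent_sub : quasicomponent M x `<=` M.
Proof. by move=> z; apply; split => //; rewrite setDv; exact: closed0. Qed.

Lemma quasicomponent_open (O : set T) : open O -> quasicomponent M x `<=` O ->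
  exists N, [/\ N x, N `<=` M, closed N, closed (M `\` N) & N `<=` O].
Proof.
move=> oO QO.
have [|||N [Nx NM Ncl MN] NO] := compact_closed_basis cT _ _ _ oO QO.
- by exists M; split => //; rewrite setDv; exact: closed0.
- move=> A B [Ax AM Acl MA] [Bx BM Bcl MB]; exists (A `&` B) => //; split => //.
  + by apply: subset_trans AM; exact: subIsetl.
  + exact: closedI.
  + by rewrite setDIr; exact: closedU.
- by move=> A [].
- by exists N.
Qed.

Lemma quasicomponent_closed : closed (quasicomponent M x).
Proof. by apply: closed_bigI => N []. Qed.

(** Normality gives an open [O] around [B1] whose closure misses [B2]. Some relatively clopen [N]
    around [x] misses the frontier of [O], so its intersection with [O] is again relatively clopen
    and contains the quasicomponent. *)
Lemma quasicomponent_unsplit (B1 B2 : set T) : closed B1 -> closed B2 ->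
  B1 `&` B2 = set0 -> B1 x -> quasicomponent M x `<=` B1 `|` B2 ->
  quasicomponent M x `<=` B1.
Proof.
move=> cl1 cl2 B12 B1x QB.
have [ O [oO B1O OB2]] : exists O, [/\ open O, B1 `<=` O & closure O `<=` ~` B2].
  have B12n : set_nbhs B1 (~` B2).
    apply/set_nbhsP; exists (~` B2); split => //; first exact: closed_openC.
    exact/disjoints_subset.
  have [V /set_nbhsP[ O [oO BO OV]] VB] := compact_normal hT cT cl1 B12n.
  by exists O; split => //; exact: subset_trans (closureS OV) VB.
have [||N [Nx NM Ncl MN NO]] := @quasicomponent_open (O `|` ~` closure O).
- by apply: openU => //; exact/closed_openC/closed_closure.
- move=> z /QB[/B1O|B2z]; [by left|right => Oz].
  exact: OB2 Oz B2z.
- have QNO : quasicomponent M x `<=` N `&` O.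
    move=> y; apply; split.
    + by split => //; exact: B1O.
    + by move=> z [/NM].
    + have -> : N `&` O = N `&` closure O.
        apply/seteqP; split => z [Nz Oz]; split => //.
          exact: subset_closure.
        by case: (NO z Nz) => // /(_ Oz).
      by apply: closedI => //; exact: closed_closure.
    + have -> : M `\` (N `&` O) = (M `\` N) `|` (N `\` O).
        apply/seteqP; split => z.
          move=> [Mz NOz]; have [Nz|Nz] := pselect (N z); last by left.
          by right; split => // Oz; exact: NOz.
        case=> [[Mz Nz]|[Nz Oz]]; first by split => // -[].
        by split=> [|[]//]; exact: NM.
      by apply: closedU => //; apply: closedI => //; exact: open_closedC.
  move=> z /[dup] /QNO[_ Oz] /QB[//|B2z].
  by have := OB2 z (subset_closure Oz).
Qed.

End quasicomponent.

(** A relatively clopen part and its complement are disjoint closed sets; by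
    [quasicomponent_unsplit], the one containing [x] is everything. *)
Lemma quasicomponent_connected (T : topologicalType) (M : set T) (x : T) :
    compact [set: T] -> hausdorff_space T -> closed M -> M x ->
  connected (quasicomponent M x).
Proof.
move=> cT hT Mcl Mx B [b Bb] [C oC BC] [D cD BD].
have Qcl := @quasicomponent_closed T M x.
have Bcl : closed B by rewrite BD; exact: closedI.
have BCcl : closed (quasicomponent M x `\` C).
  by apply: closedI => //; exact: open_closedC.
have BI : B `&` (quasicomponent M x `\` C) = set0.
  by rewrite -subset0 BC => z [[_ Cz] [_ /(_ Cz)]].
have QE : quasicomponent M x `<=` B `|` (quasicomponent M x `\` C).
  by move=> z Qz; have [Cz|Cz] := pselect (C z); [left; rewrite BC|right].
have Qx := @quasicomponent_refl T M x.
have [Cx|nCx] := pselect (C x).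
  apply/seteqP; split; first by rewrite BC; exact: subIsetl.
  by apply: quasicomponent_unsplit QE => //; rewrite BC.
have := @quasicomponent_unsplit T M x cT hT Mcl Mx _ _ BCcl Bcl _ _ _ b.
rewrite setIC setUC BI; move: Bb; rewrite BC => -[Qb Cb].
by case/(_ erefl (conj Qx nCx))=> //; rewrite -BC.
Qed.

(** The arm is the quasicomponent of [x] in [M]. Were it reduced to [x], two relatively clopen sets
    around [x] would differ by a nonempty clopen subset of [C] missing [x], against
    connectedness. *)
Lemma split_arm (T : topologicalType) (C V A : set T) (x : T) :
    compact [set: T] -> hausdorff_space T -> connected C ->
    open V -> V x -> closure V `<=` C -> open A -> ~ A x -> closure A x ->
    closed (closure V `&` (A `|` [set x])) ->
  exists L : set T, [/\ connected L, L x, L `<=` closure V,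
    L `<=` A `|` [set x] & L `&` A !=set0].
Proof.
move=> cT hT Ccon oV Vx VC oA nAx Ax; set M := (M in closed M) => Mcl.
have Mx : M x by split; [exact: subset_closure|right].
exists (quasicomponent M x); split.
- exact: quasicomponent_connected.
- exact: quasicomponent_refl.
- by move=> z /(quasicomponent_sub Mcl Mx)[].
- by move=> z /(quasicomponent_sub Mcl Mx)[].
apply: contrapT => /nonemptyPn QA0.
have Q1 : quasicomponent M x `<=` [set x].
  move=> z /[dup] Qz /(quasicomponent_sub Mcl Mx)[_ [Az|//]].
  by have : set0 z by rewrite -QA0.
have [|N [Nx NM Ncl MN NV]] := quasicomponent_open cT Mcl Mx oV.
  by move=> z /Q1 ->.
(* [A] accumulates at [x], and the part of [M] outside [N] is closed and misses [x]. The point found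
   here lies in [N]; [N'] is then chosen to omit it. *)
have [a [Aa [Va MNa]]] : A `&` (V `\` (M `\` N)) !=set0.
  apply: Ax; apply: open_nbhs_nbhs; split; last by split => // -[].
  by apply: openI => //; exact: closed_openC.
have AVM : A `&` V `<=` M.
  by move=> z [Az Vz]; split; [exact: subset_closure|left].
have Na : N a by apply: contrapT => nNa; apply: MNa; split => //; exact: AVM.
have [||N' [N'x N'M N'cl MN' N'a]] := quasicomponent_open cT Mcl Mx (O := ~` [set a]).
- by rewrite openC; apply: accessible_closed_set1; exact: hausdorff_accessible.
- by move=> z /Q1 -> xa; apply: nAx; rewrite xa.
(* Points of [N] other than [x] lie in both [V] and [A], and [x] is in [N']: this shows the
   difference to be open in [T]. *)
have DE : N `\` N' = (V `&` A) `\` (M `\` N) `\` N'.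
  apply/seteqP; split=> z.
    move=> [Nz N'z]; split => //; split; last by case.
    split; first exact: NV.
    by have [_ [//|zx]] := NM z Nz; case: N'z; rewrite zx.
  move=> [[[Vz Az] MNz] N'z]; split => //; apply: contrapT => nNz.
  by apply: MNz; split => //; exact: AVM.
have Dop : open (N `\` N').
  rewrite DE; apply: openI; last exact: closed_openC.
  by apply: openI; [exact: openI|exact: closed_openC].
have Dcl : closed (N `\` N').
  have -> : N `\` N' = N `&` (M `\` N').
    by apply/seteqP; split => z [Nz] => [N'z|[]//]; split => //; split => //; exact: NM.
  exact: closedI.
have DC : N `\` N' = C `&` (N `\` N').
  apply/seteqP; split => z [] // Nz N'z; split => //.
  exact/VC/subset_closure/NV.
have : N `\` N' = C.
  apply: Ccon; [|by exists (N `\` N')..].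
  by exists a; split => // /N'a; exact.
move/seteqP => [_ /(_ x)]; case=> //; exact/VC/subset_closure.
Qed.

(** * Splittings and their countable codes *)

Definition splits (T : topologicalType) (n : nat) (x : T) : Prop :=
  exists A : 'I_n -> set T,
    [/\ forall i, open (A i), trivIset setT A, forall i, ~ A i x,
        forall i, closure (A i) x & nbhs x ([set x] `|` \bigcup_i A i)].

(** The trace of [A k] on [L] is relatively open, and relatively closed because the other pieces
    cover the rest of [L]; hence it is all of [L]. *)
Lemma connected_trivIset (T : topologicalType) (I : Type) (A : I -> set T)
    (L : set T) (k l : I) : (forall i, open (A i)) -> trivIset setT A ->
  connected L -> L `<=` \bigcup_i A i -> L `&` A k !=set0 -> L `&` A l !=set0 ->
  k = l.
Proof.
move=> oA Adisj Lcon LA Lk [z [Lz Alz]].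
have LAk : L `&` A k = L.
  apply: Lcon => //; first by exists (A k).
  exists (~` \bigcup_(i in [set~ k]) A i).
    by apply: open_closedC; exact: bigcup_open.
  apply/seteqP; split => y [Ly].
    move=> Aky; split => // -[i ik Aiy]; apply: ik.
    by apply: Adisj => //; exists y.
  by move=> nAy; split => //; have [i _ Aiy] := LA y Ly;
    have [<-//|ik] := pselect (i = k); case: nAy; exists i.
have [_ Akz] : (L `&` A k) z by rewrite LAk.
by apply: Adisj => //; exists z.
Qed.

Lemma triple_split_unique (T : topologicalType) (x x' : T) (K : set T)
    (A A' L : 'I_3 -> set T) :
    trivIset setT A -> K `<=` [set x] `|` \bigcup_i A i ->
    (forall i, open (A' i)) -> trivIset setT A' ->
    K `<=` [set x'] `|` \bigcup_i A' i -> K x' ->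
    (forall i, [/\ connected (L i), L i x, L i `<=` K & L i `<=` A i `|` [set x]]) ->
    (forall i, L i `&` A' i !=set0) ->
  x' = x.
Proof.
move=> Adisj KA oA' A'disj KA' Kx' LP LA'; apply: contrapT => x'x.
have [j _ Ajx'] : (\bigcup_i A i) x' by case: (KA x' Kx').
(* Two distinct indices other than [j], available because there are three pieces; the arms [L k] and
   [L l] avoid [x'] and are joined at [x]. *)
pose k := lift j ord0; pose l := lift j ord_max.
have nLx' i : i != j -> ~ L i x'.
  move=> ij Lix'; have [_ _ _ /(_ x' Lix')[Aix'|//]] := LP i.
  by move/eqP: ij; apply; apply: Adisj => //; exists x'.
have LKL : L k `|` L l `<=` \bigcup_i A' i.
  move=> z [] Lz.
    have [_ _ /(_ z Lz)/KA'[zx'|//] _] := LP k.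
    by case: (nLx' k); rewrite -?zx' // eq_sym neq_lift.
  have [_ _ /(_ z Lz)/KA'[zx'|//] _] := LP l.
  by case: (nLx' l); rewrite -?zx' // eq_sym neq_lift.
have LC : connected (L k `|` L l).
  have [? ? _ _] := LP k; have [? ? _ _] := LP l.
  by apply: connectedU => //; exists x.
have [y [Ly Ay]] := LA' k; have [z [Lz Az]] := LA' l.
have : k = l.
  apply: (connected_trivIset oA' A'disj LC LKL); [exists y|exists z] => //.
    by split => //; left.
  by split => //; right.
by move/lift_inj.
Qed.

(* A 3-splitting of [x], with an arm in each piece, is recorded by a basic
   neighbourhood of [x] and a basic set inside each piece meeting its arm. *)
Definition split_code (T : topologicalType) (e : nat -> set T)
    (c : nat * {ffun 'I_3 -> nat}) (x : T) : Prop :=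
  exists A L : 'I_3 -> set T,
    [/\ e c.1 x, closure (e c.1) `<=` [set x] `|` \bigcup_i A i &
        [/\ forall i, open (A i), trivIset setT A, forall i, e (c.2 i) `<=` A i,
            forall i, L i `&` e (c.2 i) !=set0 &
            forall i, [/\ connected (L i), L i x, L i `<=` closure (e c.1) &
                         L i `<=` A i `|` [set x]]]].

(** Each basic set [e (c.2 i)] lies in a piece at [x'] and meets an arm at [x], so
    [triple_split_unique] applies with the closure of [e c.1] as [K]. *)
Lemma split_code_inj (T : topologicalType) (e : nat -> set T) c (x x' : T) :
  split_code e c x -> split_code e c x' -> x' = x.
Proof.
move=> [A [L [_ eA [_ Adisj _ Le LP]]]] [A' [_ [ex' eA' [oA' A'disj eA'i _ _]]]].
apply: (triple_split_unique Adisj eA oA' A'disj eA' _ LP).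
  exact: subset_closure.
by move=> i; have [z [Lz ez]] := Le i; exists z; split => //; exact: eA'i.
Qed.

Lemma splits_code (T : topologicalType) (e : nat -> set T) (C : set T) (x : T) :
    compact [set: T] -> hausdorff_space T -> (forall n, open (e n)) ->
    (forall y N, nbhs y N -> exists2 n, e n y & e n `<=` N) ->
    connected C -> nbhs x C -> splits 3 x ->
  exists c, split_code e c x.
Proof.
move=> cT hT eo eb Ccon xC [A [oA Adisj nAx Ax xA]].
have [V [oV Vx VN]] := compact_hausdorff_shrink cT hT (filterI xC xA).
have [n ex eV] := eb x V (open_nbhs_nbhs (conj oV Vx)).
have eN := subset_trans (closureS eV) VN.
have arm i : exists L, [/\ connected L, L x, L `<=` closure (e n),
    L `<=` A i `|` [set x] & L `&` A i !=set0].
  apply: (split_arm (C := C)) => //; first by move=> z /eN[].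
  (* Within the closure of [e n], the piece [A i] with [x] added is what the other open pieces
     leave, hence closed. *)
  have -> : closure (e n) `&` (A i `|` [set x]) =
      closure (e n) `&` ~` \bigcup_(j in [set~ i]) A j.
    apply/seteqP; split => z [ez]; last first.
      have [_ [zx|[j _ Ajz]]] := eN z ez; first by split => //; right.
      have [<-|ji] := pselect (j = i); first by split => //; left.
      by case; exists j.
    move=> Az; split => // -[j ji Ajz]; case: Az => [Aiz|zx].
      by apply: ji; apply: Adisj => //; exists z.
    by apply: (nAx j); rewrite -zx.
  apply: closedI; first exact: closed_closure.
  by apply: open_closedC; exact: bigcup_open.
have {arm}/choice[L LP] := arm.
have piece i : exists m, e m `<=` A i /\ L i `&` e m !=set0.
  have [_ _ _ _ [z [Lz Az]]] := LP i.
  have [m ez eA] := eb z (A i) (open_nbhs_nbhs (conj (oA i) Az)).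
  by exists m; split => //; exists z.
have {piece}/choice[m mP] := piece.
exists (n, [ffun i => m i]); exists A, L; split => //; first by move=> z /eN[].
by split=> // i; rewrite ?ffunE; have [] := mP i => //; have [] := LP i.
Qed.

Lemma second_countable_enum (T : topologicalType) (x0 : T) :
  @second_countable T -> exists e : nat -> set T, (forall n, open (e n)) /\
    (forall y N, nbhs y N -> exists2 n, e n y & e n `<=` N).
Proof.
move=> [B cB [Bo Bb]].
(* The point [x0] makes the base nonempty, so that [nat] can enumerate it. *)
have : $|{surjfun [set: nat] >-> B}|.
  case/pfcard_geP : cB => // B0.
  by have [U [+ _]] := Bb x0 setT filterT; rewrite B0.
case=> e; exists e; split.
  by move=> n; apply: Bo; exact: (@funS _ _ _ _ e).
move=> y N /Bb[U [BU Uy] UN].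
by have [n _ en] := @surj _ _ _ _ e U BU; exists n; rewrite en.
Qed.

Lemma exists_not_splits3 (T : topologicalType) (x0 : T) :
    compact [set: T] -> hausdorff_space T -> @second_countable T ->
    countable (range (connected_component [set: T])) ->
    (forall x : T, ~ open [set x]) ->
  exists x : T, ~ splits 3 x.
Proof.
move=> cT hT sT cC niso; apply: contrapT => /forallNP allsplit.
have [e [eo eb]] := second_countable_enum x0 sT.
have [|||_ [z _ <-] [x xC]] := Baire_compact cT hT cC _ openT.
- by move=> _ [z _ <-]; exact/component_closed/closedT.
- by exists x0.
- by move=> z _; exists (connected_component setT z); [exists z|
    exact: connected_component_refl].
have /nbhs_interior := xC; set C := connected_component _ z => xCi.
(* The sets of points sharing a code are countably many, cover the interior of [C], and are closed
   since each has at most one point. *)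
have [||||A [c _ <-] [y yc]] := Baire_compact (D := range (split_code e)) cT hT _ _
  (open_interior C).
- apply: card_le_trans (card_image_le _ _) _; exact: countableP.
- move=> _ [c _ <-].
  have [[y cy]|n] := pselect (exists y, split_code e c y).
    have -> : split_code e c = [set y].
      by apply/seteqP; split => [w cw|w ->//]; exact: split_code_inj cy cw.
    by apply: accessible_closed_set1; exact: hausdorff_accessible.
  have -> : split_code e c = set0 by apply/seteqP; split => w // cw; case: n; exists w.
  exact: closed0.
- by exists x; exact: nbhs_singleton.
- move=> y Cy; have [||c cy] := splits_code cT hT eo eb _ Cy.
  + exact: component_connected.
  + by apply: contrapT; exact: allsplit.
  + by exists (split_code e c) => //; exists c.
have cy := nbhs_singleton yc.
apply: (niso y); rewrite openE => w ->; apply: filterS yc.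
by move=> w' cw'; exact: split_code_inj cy cw'.
Qed.

(** * Homeomorphisms away from one point *)

(* A homeomorphism from [X] minus [x] onto [Y] minus [y], extended to a
   bijection from [X] to [Y] by sending [x] to [y]. *)
Definition punctured_homeo (X Y : topologicalType) (x : X) (y : Y)
    (f : X -> Y) (g : Y -> X) : Prop :=
  [/\ cancel f g, cancel g f, f x = y,
      forall a, a <> x -> {for a, continuous f} &
      forall b, b <> y -> {for b, continuous g}].

Lemma punctured_homeo_sym (X Y : topologicalType) (x : X) (y : Y) f g :
  punctured_homeo x y f g -> punctured_homeo y x g f.
Proof. by move=> [fK gK <- cf cg]; split. Qed.

Section punctured_homeo.
Variables (X Y : topologicalType) (x : X) (y : Y) (f : X -> Y) (g : Y -> X).
Hypothesis H : punctured_homeo x y f g.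

Lemma punctured_homeo_neq a : a <> x -> f a <> y.
Proof. by have [fK _ <- _ _] := H => ax /(can_inj fK). Qed.

Lemma punctured_homeo_imageN (S : set X) : ~ S x -> ~ (f @` S) y.
Proof.
by have [fK _ <- _ _] := H => Sx [s Ss /(can_inj fK) sx]; apply: Sx; rewrite -sx.
Qed.

Lemma punctured_homeo_nbhs a N : a <> x -> nbhs a N -> nbhs (f a) (f @` N).
Proof.
have [fK gK _ _ cg] := H => /punctured_homeo_neq fay aN.
have : nbhs (f a) (g @^-1` N) by apply: cg; rewrite // fK.
by apply: filterS => b Ngb; exists (g b).
Qed.

Lemma punctured_homeo_open U : open U -> ~ U x -> open (f @` U).
Proof.
move=> oU Ux; rewrite openE => _ [a Ua <-]; apply: punctured_homeo_nbhs.
  by move=> ax; apply: Ux; rewrite -ax.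
exact: open_nbhs_nbhs.
Qed.

Lemma punctured_homeo_compact K : compact K -> ~ K x -> compact (f @` K).
Proof.
have [_ _ _ cf _] := H => cK Kx; apply: continuous_compact cK.
apply/subspace_continuousP => a Ka; apply: cvg_within_filter; apply: cf.
by move=> ax; apply: Kx; rewrite -ax.
Qed.

Lemma splits_punctured_homeo n a : closed [set x] -> a <> x -> splits n a ->
  splits n (f a).
Proof.
have [fK gK _ _ _] := H => xcl ax [A [oA Adisj nAa Aa aA]].
have xa : nbhs a (~` [set x]).
  by apply: open_nbhs_nbhs; split => //; exact: closed_openC.
(* The pieces lose [x], where [f] may fail to be open; as [a] differs from [x], nothing changes near
   [a]. *)
exists (fun i => f @` (A i `\ x)); split.
- move=> i; apply: punctured_homeo_open; last by move=> [_ /(_ erefl)].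
  by apply: openI => //; exact: closed_openC.
- move=> i j _ _ [_ [[b [Aib _] <-] [c [Ajc _] /(can_inj fK) cb]]].
  by apply: Adisj => //; exists b; split => //; rewrite -cb.
- by move=> i [b [Aib _] /(can_inj fK) ba]; apply: (nAa i); rewrite -ba.
- move=> i N fN; have : nbhs a (f @^-1` N).
    have [_ _ _ cf _] := H.
    exact: cf fN.
  move=> /(filterI xa)/(Aa i)[b [Aib [bx Nfb]]].
  by exists (f b); split => //; exists b.
- apply: filterS (punctured_homeo_nbhs ax (filterI xa aA)) => _ [b [bx bA] <-].
  by case: bA => [->|[i _ Aib]]; [left|right; exists i => //; exists b].
Qed.

(** Local compactness of [Y] away from [y]: a closed neighbourhood of [a] avoiding [x] is compact,
    and [f] is continuous on it. *)
Lemma compact_nbhs_punctured_homeo a N : compact [set: X] -> hausdorff_space X ->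
  a <> x -> nbhs (f a) N ->
  exists K, [/\ compact K, K `<=` N & nbhs (f a) K].
Proof.
have [_ _ _ cf _] := H => cX hX ax /(cf a ax) faN.
have xa : nbhs a (~` [set x]).
  apply: open_nbhs_nbhs; split => //; apply: closed_openC.
  by apply: accessible_closed_set1; exact: hausdorff_accessible.
have [V [oV Va VN]] := compact_hausdorff_shrink cX hX (filterI xa faN).
exists (f @` closure V); split.
- apply: punctured_homeo_compact; last by move=> /VN[/(_ erefl)].
  exact: subclosed_compact (@closed_closure _ _) cX _.
- by move=> _ [b /VN[_ Nfb] <-].
- apply: punctured_homeo_nbhs => //; apply: filterS (@subset_closure _ V) _.
  exact: open_nbhs_nbhs.
Qed.

(** As for uniqueness of the one-point compactification: the complement of an open neighbourhood of
    [y] is compact, so [g] maps it onto a closed set missing [x]. *)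
Lemma punctured_homeo_continuous : hausdorff_space X -> compact [set: Y] ->
  continuous f.
Proof.
have [fK gK fx cf cg] := H => hX cY a.
have [->|] := pselect (a = x); last exact: cf.
move=> W; rewrite fx nbhsE => -[ O [oO Oy] OW].
have gO : closed (g @` ~` O).
  apply: compact_closed => //; apply: continuous_compact; last first.
    by apply: subclosed_compact cY _; first exact: open_closedC.
  apply/subspace_continuousP => b nOb; apply: cvg_within_filter; apply: cg.
  by move=> yb; apply: nOb; rewrite yb.
have : nbhs x (~` (g @` ~` O)).
  apply: open_nbhs_nbhs; split; first exact: closed_openC.
  by move=> [b nOb gbx]; apply: nOb; rewrite -[b]gK gbx fx.
apply: filterS => z ngOz; apply: OW; apply: contrapT => nOz.
by apply: ngOz; exists (f z).
Qed.

End punctured_homeo.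

(* The end of the noncompact space [Y] contributes the extra piece at [x]. *)
Lemma splits_add_end (X Y : topologicalType) (x : X) (y : Y) f g n :
    punctured_homeo x y f g -> compact [set: X] -> hausdorff_space X ->
    hausdorff_space Y -> ~ compact [set: Y] ->
    (forall N, nbhs y N -> exists K, [/\ compact K, K `<=` N & nbhs y K]) ->
  splits n y -> splits n.+1 x.
Proof.
move=> H; have [fK gK fx cf cg] := H; have gy : g y = x by rewrite -fx fK.
have H' := punctured_homeo_sym H.
move=> cX hX hY ncY lcY [A [oA Adisj nAy Ay yA]].
have [K [cK KA yK]] := lcY _ yA.
have Kcl := compact_closed hY cK.
(* If the image of [S] did not accumulate at [x], its closure would be a compact set missing [x],
   carried by [f] to a compact set missing [y] and containing [S]. *)
have gclosure (S : set Y) :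
    (forall K0, compact K0 -> ~ K0 y -> ~ S `<=` K0) -> closure (g @` S) x.
  move=> SK0; apply: contrapT => ncl; apply: (SK0 (f @` closure (g @` S))).
  - apply: (punctured_homeo_compact H) => //.
    exact: subclosed_compact (@closed_closure _ _) cX _.
  - exact: (punctured_homeo_imageN H).
  - by move=> s Ss; exists (g s) => //; apply: subset_closure; exists s.
(* The index [ord_max] stands for the end of [Y], the complement of [K]; the others carry the pieces
   at [y], cut down to the interior of [K]. *)
pose B (i : 'I_n.+1) := oapp (fun j => A j `&` K°) (~` K) (unlift ord_max i).
have nBy i : ~ B i y.
  rewrite /B; case: (unlift _ _) => [j [/nAy]//|/=]; apply.
  exact: nbhs_singleton.
exists (fun i => g @` (B i)); split.
- move=> i; apply: (punctured_homeo_open H') => //.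
  rewrite /B; case: (unlift _ _) => [j|] /=; last exact: closed_openC.
  by apply: openI => //; exact: open_interior.
- move=> i j _ _ [_ [[b Bib <-] [c Bjc /(can_inj gK) cb]]].
  move: Bib Bjc; rewrite cb /B.
  have KK : K° b -> ~ K b -> False by move=> /(@interior_subset _ _).
  case: unliftP => [i' ->|->]; case: unliftP => [j' ->|->] //=.
  + by move=> [Ab _] [A'b _]; congr lift; apply: Adisj => //; exists b.
  + by move=> [_ /KK + /[dup]] => /[apply].
  + by move=> nKb [_ /KK/(_ nKb)].
- by move=> i; exact: (punctured_homeo_imageN H' (nBy i)).
- move=> i; apply: gclosure => K0 cK0 K0y.
  rewrite /B; case: (unlift _ _) => [j|] /= BK0.
    have : nbhs y (K° `&` ~` K0).
      apply: filterI; first exact: nbhs_interior.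
      apply: open_nbhs_nbhs; split => //.
      exact/closed_openC/(compact_closed hY cK0).
    by move=> /(Ay j)[b [Ab [Kb]]]; apply; exact: BK0.
  (* If the complement of [K] lay in a compact [K0], then [K] and [K0] would cover [Y]. *)
  apply: ncY; apply: subclosed_compact (compactU cK cK0) _ => //.
  by move=> b _; have [Kb|/BK0] := pselect (K b); [left|right].
(* The frontier part of [K] is compact and misses [y], so its image is closed and misses [x]; off
   that image, each point other than [x] falls in a new piece. *)
- have gcl : closed (g @` (K `\` K°)).
    apply: compact_closed => //; apply: (punctured_homeo_compact H').
      apply: compact_closedI => //; apply: open_closedC; exact: open_interior.
    by move=> [_]; apply; exact: yK.
  have : nbhs x (~` (g @` (K `\` K°))).
    apply: open_nbhs_nbhs; split; first exact: closed_openC.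
    by apply: (punctured_homeo_imageN H') => -[_]; apply; exact: yK.
  apply: filterS => z gz; have [->|zx] := pselect (z = x); [by left|right].
  have [Kz|nKz] := pselect (K (f z)); last first.
    by exists ord_max => //; exists (f z) => //; rewrite /B unlift_none.
  have Kiz : K° (f z).
    by apply: contrapT => nKz; apply: gz; exists (f z).
  have [/(punctured_homeo_neq H zx)//|[j _ Aj]] := KA _ Kz.
  by exists (lift ord_max j) => //; exists (f z) => //; rewrite /B liftK.
Qed.

(** * Cards and decks *)

Lemma homeomorphic_refl (X : topologicalType) : homeomorphic X X.
Proof. by exists id, id; split => // x; exact: cvg_id. Qed.

Lemma homeomorphic_sym (X Y : topologicalType) :
  homeomorphic X Y -> homeomorphic Y X.
Proof. by move=> [f [g [cf cg fK gK]]]; exists g, f. Qed.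

Lemma deck_homeomorphic (X Y : topologicalType) (y : Y) : deck X = deck Y ->
  exists x : X, homeomorphic (point_deleted x) (point_deleted y).
Proof.
move=> XY.
have [x xy] : deck X (homeo_class (point_deleted y)) by rewrite XY; exists y.
exists x; rewrite -[homeomorphic _ _]/(homeo_class _ _) -xy.
exact: homeomorphic_refl.
Qed.

Lemma continuous_injective_hausdorff (X Y : topologicalType) (f : X -> Y) :
  continuous f -> injective f -> hausdorff_space Y -> hausdorff_space X.
Proof.
move=> cf fI hY p q pq; apply: fI; apply: hY => A B /cf pA /cf qB.
by have [z [Az Bz]] := pq _ _ pA qB; exists (f z).
Qed.

Lemma point_deleted_val_continuous (X : topologicalType) (x : X) :
  continuous (val : point_deleted x -> X).
Proof. exact: initial_continuous. Qed.

Lemma point_deleted_valP (X : topologicalType) (x : X) (a : point_deleted x) :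
  val a <> x.
Proof. by have := valP a; rewrite inE. Qed.

Lemma point_deleted_nbhs (X : topologicalType) (x : X) (a : point_deleted x) N :
  nbhs a N -> exists U, [/\ open U, U (val a) & val @^-1` U `<=` N].
Proof.
by rewrite nbhsE => -[_ [[U oU <-] Ua] UN]; exists U.
Qed.

Lemma point_deleted_hausdorff (X : topologicalType) (x : X) :
  hausdorff_space X -> hausdorff_space (point_deleted x).
Proof.
apply: continuous_injective_hausdorff (@point_deleted_val_continuous _ x) _.
exact: val_inj.
Qed.

Lemma homeomorphic_hausdorff (X Y : topologicalType) :
  homeomorphic X Y -> hausdorff_space Y -> hausdorff_space X.
Proof.
move=> [f [g [cf _ fK _]]].
exact: continuous_injective_hausdorff cf (can_inj fK).
Qed.

Section extension.
Variables (X Y : topologicalType) (x : X) (y : Y).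
Variable h : point_deleted x -> point_deleted y.

(** [insub] fails exactly at [x], where the default [y] is returned. *)
Definition point_deleted_ext (a : X) : Y := oapp (val \o h) y (insub a).

Lemma point_deleted_extx : point_deleted_ext x = y.
Proof.
by rewrite /point_deleted_ext insubF //; apply/negbTE; rewrite notin_setE; apply.
Qed.

Lemma point_deleted_ext_val a : point_deleted_ext (val a) = val (h a).
Proof. by rewrite /point_deleted_ext valK. Qed.

Lemma point_deleted_val_ex (a : X) : a <> x -> exists b : point_deleted x, val b = a.
Proof.
move=> ax; have ax' : a \in ~` [set x] by rewrite inE.
by exists (Sub a ax'); rewrite SubK.
Qed.

Lemma point_deleted_ext_continuous (a : X) : closed [set x] -> continuous h ->
  a <> x -> {for a, continuous point_deleted_ext}.
Proof.
move=> xcl ch /point_deleted_val_ex[b <-{a}] W.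
rewrite point_deleted_ext_val => hW.
have /ch/point_deleted_nbhs[U [oU Ub UW]] : nbhs (h b) (val @^-1` W).
  exact: point_deleted_val_continuous.
have : nbhs (val b) (U `\ x).
  apply: open_nbhs_nbhs; split; first by apply: openI => //; exact: closed_openC.
  by split => //; exact: point_deleted_valP.
apply: filterS => c [Uc /point_deleted_val_ex[d dc]].
by rewrite /= -dc point_deleted_ext_val; apply: UW; rewrite /= dc.
Qed.

End extension.

Lemma point_deleted_ext_can (X Y : topologicalType) (x : X) (y : Y)
    (h : point_deleted x -> point_deleted y) (k : point_deleted y -> point_deleted x) :
  cancel h k -> cancel (point_deleted_ext h) (point_deleted_ext k).
Proof.
move=> hK a; have [->|/point_deleted_val_ex[b <-]] := pselect (a = x).
  by rewrite !point_deleted_extx.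
by rewrite !point_deleted_ext_val hK.
Qed.

Lemma point_deleted_punctured_homeo (X Y : topologicalType) (x : X) (y : Y) :
    closed [set x] -> closed [set y] ->
    homeomorphic (point_deleted x) (point_deleted y) ->
  exists f g, punctured_homeo x y f g.
Proof.
move=> xcl ycl [h [k [ch ck hK kK]]].
exists (point_deleted_ext h), (point_deleted_ext k); split.
- exact: point_deleted_ext_can.
- exact: point_deleted_ext_can.
- exact: point_deleted_extx.
- by move=> a; exact: point_deleted_ext_continuous.
- by move=> b; exact: point_deleted_ext_continuous.
Qed.

(** Two points are separated in the card at some third point [c]. The T1 axiom is obtained first; it
    makes that card open in [Y], so separating sets of the card stay disjoint and open once [c] is
    removed. *)
Lemma hausdorff_of_point_deleted (Y : topologicalType) :
    (forall a b : Y, exists c, c <> a /\ c <> b) ->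
    (forall c : Y, hausdorff_space (point_deleted c)) ->
  hausdorff_space Y.
Proof.
move=> third hc.
have Y1 : accessible_space Y.
  move=> a b /eqP ab; have [c [ca cb]] := third a b.
  have [a' a'a] := point_deleted_val_ex (nesym ca).
  have [b' b'b] := point_deleted_val_ex (nesym cb).
  have /(hausdorff_accessible (hc c))[_ [[U oU <-]]] : a' != b'.
    by apply/eqP => ab'; apply: ab; rewrite -a'a ab'.
  by rewrite !inE /= => Ua Ub; exists U; rewrite !inE -a'a -b'b.
have open_neq c : open (~` [set c] : set Y).
  by apply: closed_openC; exact: accessible_closed_set1.
move=> a b; apply: contraPP => ab clab; have [c [ca cb]] := third a b.
have [a' a'a] := point_deleted_val_ex (nesym ca).
have [b' b'b] := point_deleted_val_ex (nesym cb).
suff ab' : a' = b' by apply: ab; rewrite -a'a ab'.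
apply: (hc c) => A B /point_deleted_nbhs[U [oU Ua UA]] /point_deleted_nbhs[V [oV Vb VB]].
have [||z [[Uz zc] [Vz _]]] := clab (U `\ c) (V `\ c).
- apply: open_nbhs_nbhs; split; first by apply: openI => //; exact: open_neq.
  by rewrite -a'a; split => //; exact: point_deleted_valP.
- apply: open_nbhs_nbhs; split; first by apply: openI => //; exact: open_neq.
  by rewrite -b'b; split => //; exact: point_deleted_valP.
have [z' z'z] := point_deleted_val_ex zc.
by exists z'; split; [apply: UA|apply: VB]; rewrite /= z'z.
Qed.

Lemma homeomorphic_compact (X Y : topologicalType) : homeomorphic X Y ->
  compact [set: X] -> compact [set: Y].
Proof.
move=> [f [g [cf _ _ gK]]] cX.
have -> : [set: Y] = f @` setT by apply/seteqP; split => // z _; exists (g z).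
by apply: continuous_compact => //; exact: continuous_subspaceT.
Qed.

Lemma homeomorphic_second_countable (X Y : topologicalType) : homeomorphic X Y ->
  @second_countable X -> @second_countable Y.
Proof.
move=> [f [g [cf cg fK gK]]] [B cB [Bo Bb]].
exists ((fun U => g @^-1` U) @` B); first exact: card_le_trans (card_image_le _ _) cB.
split; first by move=> _ [U BU <-]; apply: open_comp; [move=> ? _; exact: cg|exact: Bo].
move=> y N yN.
have : nbhs (g y) (f @^-1` N) by apply: cf; rewrite gK.
move=> /Bb[U [BU Ugy] UN]; exists (g @^-1` U).
  by split => //; exists U.
by move=> z /UN; rewrite /= gK.
Qed.

Lemma metric_compact_second_countable (R : realType) (M : metricType R) :
  compact [set: M] -> @second_countable M.
Proof.
move=> cM; have [[m _]|n] := pselect ([set: M] !=set0); last first.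
  exists set0 => //; split => // x; case: n; exists x => //.
pose P : pseudoPMetricType R := HB.pack (M : Type) (isPointed.Build M m) (Metric.class M).
exact: (@compact_second_countable R P).
Qed.

(** The complement of [x] is the single piece; it accumulates at [x] because [x] is not isolated. *)
Lemma splits1 (X : topologicalType) (x : X) : closed [set x] -> ~ open [set x] ->
  splits 1 x.
Proof.
move=> xcl xo; exists (fun=> ~` [set x]); split.
- by move=> _; exact: closed_openC.
- by move=> i j _ _ _; rewrite !ord1.
- by move=> _; apply.
- move=> _ N xN; apply: contrapT => /nonemptyPn NE; apply: xo.
  rewrite openE => _ ->; apply: filterS xN => z Nz; apply: contrapT => zx.
  by have : set0 z by rewrite -NE.
- apply: filterS filterT => z _.
  by have [zx|zx] := pselect (z = x); [left|right; exists ord0].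
Qed.

(** * From equal decks to a homeomorphism *)

Theorem corollary4p14 (R : realType) (X : topologicalType)
    (X3 : at_least_three_points X)
    (Xcompact : compact [set: X])
    (Xmetrizable : metrizable R X)
    (Xcomponents : countable (range (connected_component [set: X]))) :
  reconstructible X.
Proof.
move=> Y XY; have [M XM] := Xmetrizable.
have hX : hausdorff_space X.
  exact: homeomorphic_hausdorff XM (@metric_hausdorff R M).
have sX : @second_countable X.
  apply: homeomorphic_second_countable (homeomorphic_sym XM) _.
  apply: metric_compact_second_countable; exact: homeomorphic_compact Xcompact.
have X3' (x : X) : exists p q : point_deleted x, p <> q.
  have [p [q [pq px qx]]] : exists p q, [/\ p <> q, p <> x & q <> x].
    have [a [b [c [ab ac bc]]]] := X3.
    have [ax|ax] := pselect (a = x); first by exists b, c; split; rewrite -?ax; auto.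
    have [bx|bx] := pselect (b = x); first by exists a, c; split; rewrite -?bx; auto.
    by exists a, b.
  have [p' p'p] := point_deleted_val_ex px; have [q' q'q] := point_deleted_val_ex qx.
  by exists p', q' => pq'; apply: pq; rewrite -p'p pq'.
have hY : hausdorff_space Y.
  (* The card of [Y] at [a] is homeomorphic to a card of [X], so it has two points, one of which
     differs from [b]. *)
  apply: hausdorff_of_point_deleted => [a b|c].
    have [x [h [k [_ _ hK _]]]] := deck_homeomorphic a XY.
    have [p [q pq]] := X3' x.
    have [hpb|] := pselect (val (h p) = b); last first.
      by exists (val (h p)); split => //; exact: point_deleted_valP.
    exists (val (h q)); split; first exact: point_deleted_valP.
    by rewrite -hpb => /val_inj/(can_inj hK)/esym.
  have [x xc] := deck_homeomorphic c XY.
  apply: homeomorphic_hausdorff (homeomorphic_sym xc) _.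
  exact: point_deleted_hausdorff.
have cl1X (x : X) : closed [set x].
  by apply: accessible_closed_set1; exact: hausdorff_accessible.
have cl1Y (y : Y) : closed [set y].
  by apply: accessible_closed_set1; exact: hausdorff_accessible.
have toX (y : Y) : exists x f g, @punctured_homeo X Y x y f g.
  have [x xy] := deck_homeomorphic y XY.
  by exists x; exact: point_deleted_punctured_homeo.
have toY (x : X) : exists y f g, @punctured_homeo X Y x y f g.
  have [y xy] := deck_homeomorphic x (esym XY).
  by exists y; apply: point_deleted_punctured_homeo => //; exact: homeomorphic_sym.
have [x0 _] := X3.
have [cY|ncY] := pselect (compact [set: Y]).
  have [y0 [f [g H]]] := toY x0; exists f, g; have [fK gK _ _ _] := H; split => //.
    exact: punctured_homeo_continuous H _ _.
  exact: punctured_homeo_continuous (punctured_homeo_sym H) _ _.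
(* Deleting an isolated [x] would leave a compact card, and [Y] would be its image with one point
   added. *)
have noiso (x : X) : ~ open [set x].
  move=> xo; apply: ncY; have [y [f [g H]]] := toY x.
  have -> : [set: Y] = f @` (~` [set x]) `|` [set y].
    apply/seteqP; split => // z _; have [_ gK fx _ _] := H.
    have [zy|zy] := pselect (z = y); first by right.
    by left; exists (g z) => //= gzx; apply: zy; rewrite -[z]gK gzx.
  apply: compactU; last exact: compact_set1.
  apply: punctured_homeo_compact H _ _ _; last by apply.
  by apply: subclosed_compact Xcompact _ => //; exact: open_closedC.
have other (y : Y) : exists y', y' <> y.
  have [x [h _]] := deck_homeomorphic y XY; have [p _] := X3' x.
  by exists (val (h p)); exact: point_deleted_valP.
have allsplit n (x : X) : splits n.+1 x.
  elim: n x => [x|n IHn x]; first exact: splits1.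
  have [y [f [g H]]] := toY x; have [y' y'y] := other y.
  (* A second match, deleting [y'] instead of [y], makes [y] the image of an ordinary point of [X]:
     both local compactness at [y] and the splitting given by [IHn] come from there. *)
  have [x' [f' [g' H']]] := toX y'.
  have [_ g'K _ _ _] := H'.
  have g'y : g' y <> x'.
    by apply: (punctured_homeo_neq (punctured_homeo_sym H')); exact: nesym.
  apply: (splits_add_end H) => //.
    rewrite -[y]g'K => N; exact: (compact_nbhs_punctured_homeo H').
  by rewrite -[y]g'K; apply: (splits_punctured_homeo H').
by have [x] := exists_not_splits3 x0 Xcompact hX sX Xcomponents noiso.
Qed.
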